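(* Let $d\in\mathbb{N}$, let $\varphi\in\mathcal{A}_d$ be arbitrary and let $\theta\in(0,1)$. Then $$-\frac{\varphi(1)-\varphi(\theta)}{1-\theta}\leq D^{+}\varphi(\theta)\leq\frac{\varphi(\theta)}{1-\theta}.$$ In particular, $\varphi$ is $d/\delta$-Lipschitz on $[0,1-\delta]$ for any $\delta>0$.
   Context: For $d\in\mathbb{N}$, $\mathcal{A}_d$ denotes the set of functions $\varphi\colon(0,1)\to[0,d]$ such that for all $0<\lambda<\theta<1$, $$0\leq (1-\lambda)\varphi(\lambda)-(1-\theta)\varphi(\theta)\leq(\theta-\lambda)\,\varphi\Bigl(\frac{\lambda}{\theta}\Bigr).$$ Every $\varphi\in\mathcal{A}_d$ is uniformly continuous on $(0,1)$ and is extended continuously to $[0,1]$ by $\varphi(0)=\lim_{\theta\to0}\varphi(\theta)$ and $\varphi(1)=\lim_{\theta\to1}\varphi(\theta)$. The upper right Dini derivative is $D^{+}f(x)=\limsup_{\varepsilon\searrow 0}\frac{f(x+\varepsilon)-f(x)}{\varepsilon}$. The interval $[0,1-\delta]$ is empty if $\delta>1$. *)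

(* Defs.v *)
From HB Require Import structures.
From mathcomp Require Import all_boot all_order all_algebra.
From mathcomp Require Import all_classical all_reals all_analysis.

Set Implicit Arguments.
Unset Strict Implicit.
Unset Printing Implicit Defensive.

Import Order.TTheory GRing.Theory Num.Theory.
Import numFieldNormedType.Exports.

Local Open Scope classical_set_scope.
Local Open Scope ring_scope.

(* A function on (0,1) is represented by a total function on R whose values
   outside (0,1) are never used. *)
Definition classA (R : realType) (d : nat) (phi : R -> R) : Prop :=
  (forall x : R, 0 < x < 1 -> 0 <= phi x <= d%:R) /\
  (forall l t : R, 0 < l -> l < t -> t < 1 ->
     0 <= (1 - l) * phi l - (1 - t) * phi t <= (t - l) * phi (l / t)).

(* The extension to [0,1] by one-sided limits at the end points; it agrees
   with phi elsewhere. *)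
Definition ext01 (R : realType) (phi : R -> R) (x : R) : R :=
  if x == 0 then lim (phi t @[t --> (0 : R)^'+])
  else if x == 1 then lim (phi t @[t --> (1 : R)^'-])
  else phi x.

Definition upper_right_dini (R : realType) (f : R -> R) (x : R) : \bar R :=
  limf_esup (fun e : R => ((f (x + e) - f x) / e)%:E) (0 : R)^'+.

(* Main.v *)
(* The second inequality defining the class, telescoped along the powers
   s^k, bounds (1 - s^n) phi (s^n) by (1 - s^n) phi s. Squeezing a given x
   between two consecutive powers of s and letting s tend to 1 shows that
   phi tends to its supremum at 1. Hence phi (theta / (theta + e)) <= phi 1,
   so the two defining inequalities applied to (theta, theta + e) bound the
   difference quotient from both sides by quantities converging to the claimed
   bounds. Using phi <= d instead gives the Lipschitz estimate directly. *)
Require Import Defs.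
From mathcomp Require Import all_boot all_order all_algebra.
From mathcomp Require Import all_classical all_reals all_analysis.
From mathcomp Require Import ring lra.

Set Implicit Arguments.
Unset Strict Implicit.
Unset Printing Implicit Defensive.

Import Order.TTheory GRing.Theory Num.Theory.
Import numFieldNormedType.Exports.

Local Open Scope classical_set_scope.
Local Open Scope ring_scope.

(** * Comparison bounds for an upper limit along a filter *)

Lemma ge_limf_esup (R : realType) (T : choiceType) (X : filteredType T)
    (F : set_system X) (f g : X -> R) (b : R) {FF : ProperFilter F} :
  g @ F --> b -> (\forall x \near F, f x <= g x) ->
  (limf_esup (fun x => (f x)%:E) F <= b%:E)%E.
Proof.
move=> gb fg; apply/lee_addgt0Pr => e e0.
(* [limf_esup] is an infimum over the members of [F], and this sublevel set of [f] is one of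
   them. *)
apply: (@le_trans _ _ (ereal_sup ((fun x => (f x)%:E) @` [set x | f x <= b + e]))).
  apply: ereal_inf_lbound; exists [set x | f x <= b + e] => //.
  have : \forall x \near F, g x <= b + e by apply: cvgr_le gb _ _; lra.
  by apply: filterS2 fg => x; exact: le_trans.
by apply: ge_ereal_sup => _ [x fx <-]; rewrite -EFinD lee_fin.
Qed.

Lemma le_limf_esup (R : realType) (T : choiceType) (X : filteredType T)
    (F : set_system X) (f g : X -> R) (a : R) {FF : ProperFilter F} :
  g @ F --> a -> (\forall x \near F, g x <= f x) ->
  (a%:E <= limf_esup (fun x => (f x)%:E) F)%E.
Proof.
move=> ga gf; apply: le_ereal_inf_tmp => _ [V FV <-].
apply/lee_addgt0Pr => e e0.
have gae : \forall x \near F, a - e <= g x by apply: cvgr_ge ga _ _; lra.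
have [x [[gfx gaex] Vx]] := filter_ex (filterI (filterI gf gae) FV).
rewrite -leeBlDr//; apply: le_ereal_sup_tmp; exists (f x)%:E; first by exists x.
by rewrite -EFinB lee_fin (le_trans gaex).
Qed.

(** * Powers of [s] and the limit of [phi] at 1 *)

Lemma expr_sandwich (R : archiRealFieldType) (s x : R) :
  0 < s < 1 -> 0 < x < 1 -> exists n, s * x < s ^+ n.+1 <= x.
Proof.
move=> /andP[s0 s1] /andP[x0 x1].
have ex_n : exists n, s ^+ n <= x.
  have : (GRing.exp s : R ^nat) @ \oo --> 0.
    by apply: cvg_expr; rewrite gtr0_norm.
  by move=> /cvgr_le/(_ x x0)/filter_ex.
(* The least exponent is not 0 because [x < 1]; by minimality the previous power still exceeds
   [x]. *)
case: (ex_minnP ex_n) => -[|n] sn_le sn_min.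
  by move: sn_le; rewrite expr0 leNgt x1.
exists n; rewrite sn_le andbT exprS ltr_pM2l// ltNge.
by apply/negP => /sn_min; rewrite ltnn.
Qed.

Section ClassA.
Variables (R : realType) (d : nat) (phi : R -> R).
Hypothesis hphi : classA d phi.

Lemma classA_ge0 x : 0 < x < 1 -> 0 <= phi x.
Proof. by case: hphi => h _ /h /andP[]. Qed.

Lemma classA_le x : 0 < x < 1 -> phi x <= d%:R.
Proof. by case: hphi => h _ /h /andP[]. Qed.

Lemma classA_decr l t : 0 < l -> l < t -> t < 1 ->
  (1 - t) * phi t <= (1 - l) * phi l.
Proof. by move=> l0 lt t1; have [_ /(_ _ _ l0 lt t1) /andP[h _]] := hphi; lra. Qed.

Lemma classA_decr_le l t : 0 < l -> l < t -> t < 1 ->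
  (1 - l) * phi l - (1 - t) * phi t <= (t - l) * phi (l / t).
Proof. by move=> l0 lt t1; have [_ /(_ _ _ l0 lt t1) /andP[]] := hphi. Qed.

Lemma ratio_itv (l t : R) : 0 < l -> l < t -> 0 < l / t < 1.
Proof.
move=> l0 lt; have t0 := lt_trans l0 lt.
by rewrite divr_gt0// ltr_pdivrMr// mul1r.
Qed.

(** Consecutive powers have ratio [s], so each step adds at most their difference times [phi s], and
    these differences telescope. *)
Lemma classA_expr s n : 0 < s < 1 ->
  (1 - s ^+ n.+1) * phi (s ^+ n.+1) <= (1 - s ^+ n.+1) * phi s.
Proof.
move=> /andP[s0 s1]; elim: n => [|n ih]; first by rewrite expr1.
have sn0 : 0 < s ^+ n.+1 by exact: exprn_gt0.
have sn1 : s ^+ n.+1 < 1 by rewrite exprn_ilt1// ltW.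
have := @classA_decr_le (s ^+ n.+2) (s ^+ n.+1) (exprn_gt0 _ s0) _ sn1.
rewrite [s ^+ n.+2]exprS mulfK ?gt_eqF//; move: (s ^+ n.+1) sn0 sn1 ih.
move=> u u0 u1 ih /(_ _) h.
have {}h := h (_ : s * u < u); have su : s * u < u by nra.
by move: (h su); lra.
Qed.

(** Monotonicity of [(1 - t) * phi t] replaces [x] by a power [u] of [s] with [s * x < u <= x]; then
    [classA_expr] applies, and [0 <= phi s] allows [1 - u] to grow to [1 - s * x]. *)
Lemma classA_lower_near1 x s : 0 < x < 1 -> 0 < s < 1 ->
  (1 - x) * phi x <= (1 - s * x) * phi s.
Proof.
move=> x01 s01; have [n /andP[sxn nx]] := expr_sandwich s01 x01.
have n0 : 0 < s ^+ n.+1 by rewrite exprn_gt0//; case/andP: s01.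
have phis := classA_ge0 s01.
have := classA_expr n s01; case/andP: x01 => x0 x1.
have : (1 - x) * phi x <= (1 - s ^+ n.+1) * phi (s ^+ n.+1).
  by move: nx; rewrite le_eqVlt => /predU1P[->//|nx]; apply: classA_decr.
move: (s ^+ n.+1) sxn => u su h1 h2; nra.
Qed.

Let phi01 := phi @` `]0, 1[%classic.

Lemma has_sup_classA : has_sup phi01.
Proof.
split; first by exists (phi 2^-1), 2^-1 => //=; rewrite in_itv/=; lra.
by exists d%:R => _ [x + <-]; rewrite /= in_itv/=; exact: classA_le.
Qed.

Lemma cvg_classA_left1 : phi t @[t --> 1^'-] --> sup phi01.
Proof.
apply/cvgrPdist_le => e e0.
have e20 : 0 < e / 2 by lra.
have [_ [x + <-] supx] := sup_adherent e20 has_sup_classA.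
rewrite /= in_itv/= => x01; have /andP[x0 x1] := x01.
have d1 : 0 < d%:R + 1 :> R by rewrite ltr_wpDl.
(* Beyond this threshold the loss [x * (1 - s) * phi s] is at most [(e / 2) * (1 - x)]. Using
   [d + 1] keeps the divisor positive when [d = 0]. *)
have s1 : 1 - (e / 2) * (1 - x) / (d%:R + 1) < 1.
  by rewrite ltrBlDr ltrDl divr_gt0// mulr_gt0// subr_gt0.
near=> s.
have s01 : 0 < s < 1.
  by apply/andP; split; near: s; [exact: nbhs_left_gt|exact: nbhs_left_lt].
have h := classA_lower_near1 x01 s01.
have sd : (1 - s) * (d%:R + 1) <= (e / 2) * (1 - x).
  rewrite -ler_pdivlMr// lerBlDr addrC -lerBlDr.
  by near: s; exact: nbhs_left_ge.
have sup_ge : phi s <= sup phi01.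
  by apply: (sup_upper_bound has_sup_classA); exists s => //=; rewrite in_itv.
rewrite ger0_norm ?subr_ge0//.
have := classA_le s01; have := classA_ge0 s01.
case/andP: s01 => s0 ss1 ps0 psd.
have : (1 - x) * (phi x - phi s) <= (1 - x) * (e / 2).
  have : x * (1 - s) * phi s <= (1 - s) * (d%:R + 1).
    have : x * phi s <= d%:R + 1 by nra.
    by nra.
  nra.
rewrite ler_pM2l ?subr_gt0//; lra.
Unshelve. all: by end_near. Qed.

Lemma classA_le_ext1 x : 0 < x < 1 -> phi x <= ext01 phi 1.
Proof.
move=> x01; rewrite /ext01 oner_eq0 eqxx (cvg_lim _ cvg_classA_left1)//.
by apply: (sup_upper_bound has_sup_classA); exists x => //=; rewrite in_itv.
Qed.

Lemma ext01_in x : 0 < x < 1 -> ext01 phi x = phi x.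
Proof. by move=> /andP[x0 x1]; rewrite /ext01 gt_eqF// lt_eqF. Qed.

(** * Increments, the limit at 0 and the Lipschitz estimate *)

Lemma classA_increment_le l t : 0 < l -> l < t -> t < 1 ->
  (1 - t) * (phi t - phi l) <= (t - l) * phi l.
Proof. by move=> l0 lt t1; have := classA_decr l0 lt t1; lra. Qed.

Lemma classA_increment_ge l t : 0 < l -> l < t -> t < 1 ->
  (t - l) * (phi t - phi (l / t)) <= (1 - l) * (phi t - phi l).
Proof. by move=> l0 lt t1; have := classA_decr_le l0 lt t1; lra. Qed.

Lemma classA_lipschitz l t : 0 < l -> l < t -> t < 1 ->
  `|phi t - phi l| <= d%:R / (1 - t) * (t - l).
Proof.
move=> l0 lt t1; have := classA_increment_le l0 lt t1.
have := classA_increment_ge l0 lt t1.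
have t01 : 0 < t < 1 by lra.
have l01 : 0 < l < 1 by lra.
have := classA_ge0 t01; have := classA_le l01.
have := classA_le (ratio_itv l0 lt).
rewrite mulrAC ler_pdivlMr ?subr_gt0// mulrC => pld pd pt h1 h2.
rewrite -[1 - t]gtr0_norm ?subr_gt0// -normrM ler_norml.
apply/andP; split; last by nra.
(* The lower increment bound carries the factor [1 - l]; it may be shrunk to [1 - t] when [phi]
   decreases from [l] to [t], and otherwise the claim is a matter of sign. *)
have [pp|pp] := leP (phi t) (phi l); nra.
Qed.

(** The bounded function [(1 - t) * phi t] is nonincreasing, hence converges at 0; dividing by
    [1 - t], which tends to 1, recovers [phi]. Thus the [lim] in [ext01] at 0 is a genuine limit. *)
Lemma is_cvg_classA_right0 : cvg (phi t @[t --> 0^'+]).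
Proof.
have cvg_g : cvg (((1 - t) * phi t) @[t --> 0^'+]).
  apply: nonincreasing_at_right_is_cvgr; near=> b.
    move=> l t; rewrite !in_itv/= => /andP[l0 _] /andP[_ tb].
    rewrite le_eqVlt => /predU1P[->//|lt]; apply: classA_decr => //.
    by rewrite (lt_trans tb)//; near: b; exact: nbhs_right_lt.
  exists d%:R => _ [t + <-]; rewrite /= in_itv/= => /andP[t0 tb].
  have t01 : 0 < t < 1.
    by rewrite t0 (lt_trans tb)//; near: b; exact: nbhs_right_lt.
  by have := classA_ge0 t01; have := classA_le t01; nra.
have cvg1B : (1 - t)^-1 @[t --> (0 : R)^'+] --> (1 - 0 : R)^-1.
  apply: cvg_at_right_filter; apply: cvgV; first by rewrite subr0 oner_eq0.
  by apply: cvgB; [exact: cvg_cst|exact: cvg_id].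
apply/cvg_ex; eexists.
apply: cvg_trans (cvgM cvg1B cvg_g); apply: near_eq_cvg; near=> t.
have t1 : t < 1 by near: t; exact: nbhs_right_lt.
by rewrite /= mulKf// subr_eq0 gt_eqF.
Unshelve. all: by end_near. Qed.

Lemma ext01_lipschitz_lt l t : 0 <= l -> l < t -> t < 1 ->
  `|ext01 phi t - ext01 phi l| <= d%:R / (1 - t) * (t - l).
Proof.
rewrite le_eqVlt => /predU1P[<- t0 t1|l0 lt t1]; last first.
  by rewrite !ext01_in ?classA_lipschitz//; lra.
rewrite ext01_in ?t0// {1}/ext01 eqxx.
(* For left end point 0, the estimate on [(u, t)] passes to the limit in [u], its constant depending
   on [t] alone. *)
have cvg_dist : `|phi t - phi l| @[l --> 0^'+] -->
    `|phi t - lim (phi l @[l --> 0^'+])|.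
  by apply: cvg_norm; apply: cvgB; [exact: cvg_cst|exact: is_cvg_classA_right0].
apply: (cvgr_to_le cvg_dist); near=> u.
have u0 : 0 < u by near: u; exact: nbhs_right_gt.
have ut : u < t by near: u; exact: nbhs_right_lt.
apply: (le_trans (classA_lipschitz u0 ut t1)).
by rewrite ler_wpM2l ?divr_ge0 ?subr_ge0 ?(ltW t1)//; lra.
Unshelve. all: by end_near. Qed.

(** The interval stops short of 1, so of the two limit values only the one at 0 enters, and
    [delta <= 1 - t] makes the constant uniform. *)
Lemma ext01_lipschitz (delta : R) : 0 < delta ->
  (d%:R / delta).-lipschitz_(`[0, 1 - delta]) (ext01 phi).
Proof.
move=> delta0.
have lip l t : 0 <= l -> l < t -> t <= 1 - delta ->
    `|ext01 phi t - ext01 phi l| <= d%:R / delta * (t - l).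
  move=> l0 lt td; apply: le_trans (ext01_lipschitz_lt l0 lt _) _; first by lra.
  rewrite ler_wpM2r ?subr_ge0 ?(ltW lt)// ler_wpM2l// lef_pV2 ?posrE//; lra.
move=> [x y] [/=]; rewrite !in_itv/= => /andP[x0 xd] /andP[y0 yd].
case: (ltgtP x y) => [xy|yx|->].
- by rewrite distrC [X in _ <= _ * X]distrC (gtr0_norm (_ : 0 < y - x)) ?lip ?subr_gt0.
- by rewrite (gtr0_norm (_ : 0 < x - y)) ?lip ?subr_gt0.
- by rewrite !subrr !normr0 mulr0.
Qed.

(** * The two bounds on the Dini derivative *)

Lemma upper_right_dini_le theta : 0 < theta < 1 ->
  (upper_right_dini (ext01 phi) theta <= (phi theta / (1 - theta))%:E)%E.
Proof.
move=> /andP[th0 th1].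
have cvg_bound : phi theta / (1 - (theta + e)) @[e --> 0^'+] -->
    phi theta / (1 - (theta + 0)).
  apply: cvg_at_right_filter; apply: cvgM; first exact: cvg_cst.
  apply: cvgV; first by rewrite addr0 subr_eq0 gt_eqF.
  apply: cvgB; first exact: cvg_cst.
  by apply: cvgD; [exact: cvg_cst|exact: cvg_id].
rewrite addr0 in cvg_bound.
rewrite /upper_right_dini; apply: (ge_limf_esup cvg_bound); near=> e.
have e0 : 0 < e by near: e; exact: nbhs_right_gt.
have e1 : e < 1 - theta by near: e; apply: nbhs_right_lt; rewrite subr_gt0.
rewrite !ext01_in; [|lra|lra].
have := @classA_increment_le theta (theta + e) th0.
move=> /(_ ltac:(lra) ltac:(lra)) h.
rewrite ler_pdivrMr// mulrAC ler_pdivlMr; last by lra.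
by move: h; lra.
Unshelve. all: by end_near. Qed.

Lemma upper_right_dini_ge theta : 0 < theta < 1 ->
  ((- ((ext01 phi 1 - phi theta) / (1 - theta)))%:E
     <= upper_right_dini (ext01 phi) theta)%E.
Proof.
move=> /andP[th0 th1].
have cvg_phi : phi (theta + e) @[e --> 0^'+] --> phi theta.
  (* A Lipschitz constant valid for all [e < (1 - theta) / 2], since then [1 - (theta + e)] exceeds
     [(1 - theta) / 2]. *)
  pose c := d%:R / ((1 - theta) / 2) : R.
  have cvg_ce : c * e @[e --> 0^'+] --> c * 0.
    by apply: cvg_at_right_filter; apply: cvgMr; exact: cvg_id.
  rewrite mulr0 in cvg_ce.
  apply/cvgrPdist_le => eps eps0; near=> e.
  have e0 : 0 < e by near: e; exact: nbhs_right_gt.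
  have e1 : e < (1 - theta) / 2 by near: e; apply: nbhs_right_lt; lra.
  have ce : c * e <= eps by near: e; exact: (cvgr_le _ cvg_ce).
  rewrite distrC; apply: le_trans ce.
  have := @classA_lipschitz theta (theta + e) th0.
  move=> /(_ ltac:(lra) ltac:(lra)) /le_trans; apply.
  rewrite [theta + e - theta]addrAC subrr add0r ler_wpM2r ?(ltW e0)//.
  by rewrite ler_wpM2l// lef_pV2 ?posrE//; lra.
(* This minorant of the difference quotient comes from [classA_increment_ge] after bounding
   [phi (theta / (theta + e))] by the value at 1; right continuity at [theta] gives its limit. *)
have cvg_bound : (phi (theta + e) - ext01 phi 1) / (1 - theta) @[e --> 0^'+] -->
    (phi theta - ext01 phi 1) / (1 - theta).
  by apply: cvgMl; apply: cvgB => //; exact: cvg_cst.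
rewrite -mulNr opprB /upper_right_dini; apply: (le_limf_esup cvg_bound); near=> e.
have e0 : 0 < e by near: e; exact: nbhs_right_gt.
have e1 : e < 1 - theta by near: e; apply: nbhs_right_lt; rewrite subr_gt0.
rewrite (ext01_in (x := theta)) ?(ext01_in (x := theta + e)); [|lra|lra].
have tte : theta < theta + e by lra.
have := classA_increment_ge th0 tte ltac:(lra).
have := classA_le_ext1 (ratio_itv th0 tte) => le1 h.
rewrite ler_pdivrMr ?subr_gt0// mulrAC ler_pdivlMr//.
by nra.
Unshelve. all: by end_near. Qed.

End ClassA.

Theorem proposition2p4 (R : realType) (d : nat) (phi : R -> R)
    (hphi : classA d phi) :
  (forall theta : R, 0 < theta < 1 ->
     ((- ((ext01 phi 1 - ext01 phi theta) / (1 - theta)))%:E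
        <= upper_right_dini (ext01 phi) theta
        <= (ext01 phi theta / (1 - theta))%:E)%E) /\
  (forall delta : R, 0 < delta ->
     (d%:R / delta).-lipschitz_(`[0, 1 - delta]) (ext01 phi)).
Proof.
split=> [theta th01|]; last exact: ext01_lipschitz hphi.
rewrite (ext01_in phi th01).
by rewrite (upper_right_dini_ge hphi th01) (upper_right_dini_le hphi th01).
Qed.
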